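(* The map $$\mathcal{C}:\ \mathcal{A}\times \mathrm{SO}(3)\times \mathrm{SO}(3)\to Q,\qquad (A,U_l,U_r)\mapsto U_l\,A\,U_r^T$$ is a 4-fold covering map, and it maps solutions of Riemann's equation $$\mathbb{P}_A\Big[\ddot A+2(\Omega_l\dot A-\dot A\,\Omega_r)+(\dot\Omega_l A-A\dot\Omega_r)+(\Omega_l^2A-2\Omega_lA\Omega_r+A\Omega_r^2)+\mathcal{V}'(A)\Big]=0,\qquad \Omega_l=U_l^T\dot U_l,\quad \Omega_r=U_r^T\dot U_r,$$ for curves $t\mapsto(A(t),U_l(t),U_r(t))\in\mathcal{A}\times \mathrm{SO}(3)\times \mathrm{SO}(3)$, into solutions of Dirichlet's equation $$\mathbb{P}_F\big[\ddot F+U_l\,\mathcal{V}'(A)\,U_r^T\big]=0$$ for curves $t\mapsto F(t)\in Q\subset \mathrm{SL}(3)$, where $(A(t),U_l(t),U_r(t))$ denotes any singular value decomposition of $F(t)$.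
   Context: All matrices are real $3\times3$ matrices; $\mathrm{SL}(3)=\mathrm{SL}(3,\mathbb{R})$. The inner product on $3\times 3$ matrices is $\langle A,B\rangle=\mathrm{tr}(AB^T)$. For invertible $F$ and any $3\times3$ matrix $G$, $$\mathbb{P}_F G=G-\tfrac13\langle G,F\rangle F^{-T}.$$ A singular value decomposition (SVD) of $F\in \mathrm{SL}(3)$ is a triple $(A,U_l,U_r)$ with $F=U_lAU_r^T$, $U_l,U_r\in \mathrm{SO}(3)$ and $A=\mathrm{diag}(a_1,a_2,a_3)$, where $a_1,a_2,a_3$ are the singular values of $F$ (eigenvalues of $\sqrt{FF^T}$). Sets: $$\mathcal{A}=\big\{\mathrm{diag}(a_1,a_2,(a_1a_2)^{-1}):\ a_1>a_2>a_1^{-1/2}\big\},\qquad Q=\{F\in \mathrm{SL}(3): F\text{ has distinct singular values}\}.$$ Potential: for a constant $g>0$ (gravitational constant) and $a=(a_1,a_2,a_3)$ with positive entries, $$\mathcal{V}(a)=-2\pi g\int_0^\infty\big[(s+a_1^2)(s+a_2^2)(s+a_3^2)\big]^{-1/2}ds,$$ and for $A=\mathrm{diag}(a_1,a_2,a_3)$, $\mathcal{V}'(A)=\mathrm{diag}\big(\frac{\partial\mathcal V}{\partial a_1},\frac{\partial\mathcal V}{\partial a_2},\frac{\partial\mathcal V}{\partial a_3}\big)$, the partial derivatives being taken with $a_1,a_2,a_3$ regarded as independent variables. The matrix $U_l\mathcal{V}'(A)U_r^T$ does not depend on the choice of the SVD of $F$. *)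

(* Defs.v *)
From HB Require Import structures.
From mathcomp Require Import all_boot all_order all_algebra.
From mathcomp Require Import ring lra.
From mathcomp Require Import all_classical all_reals all_analysis.

Set Implicit Arguments.
Unset Strict Implicit.
Unset Printing Implicit Defensive.

Import Order.TTheory GRing.Theory Num.Theory.
Import numFieldNormedType.Exports.

Local Open Scope classical_set_scope.
Local Open Scope ring_scope.

Definition homeomorphism_on (X Y : topologicalType) (V : set X) (U : set Y)
    (p : X -> Y) : Prop :=
  [/\ set_fun V U p, {within V, continuous p} &
    exists q : Y -> X, [/\ set_fun U V q, {within U, continuous q},
      (forall x, V x -> q (p x) = x) & (forall y, U y -> p (q y) = y)]].

Definition covering_map (n : nat) (X Y : topologicalType) (p : X -> Y) : Prop :=
  continuous p /\
  forall y : Y, exists2 U : set Y, open_nbhs y U &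
    exists V : 'I_n -> set X,
      [/\ forall i, open (V i), trivIset setT V,
          \bigcup_i V i = p @^-1` U &
          forall i, homeomorphism_on (V i) U p].

Definition mxdot (R : realType) (A B : 'M[R]_3) : R := \tr (A *m B^T).

Definition projF (R : realType) (F G : 'M[R]_3) : 'M[R]_3 :=
  G - (3^-1 * mxdot G F) *: (invmx F)^T.

Definition SL3 (R : realType) : set 'M[R]_3 := [set F | \det F = 1].

Definition SO3 (R : realType) : set 'M[R]_3 :=
  [set U | U *m U^T = 1%:M /\ \det U = 1].

Definition psd_sqrt (R : realType) (S P : 'M[R]_3) : Prop :=
  [/\ P^T = P, forall v : 'rV[R]_3, 0 <= (v *m P *m v^T) 0 0 & P *m P = S].

(* The entries of a list the eigenvalues of the square root of F F^T with
   multiplicity, in an arbitrary order. *)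
Definition singular_values (R : realType) (F : 'M[R]_3) (a : 'rV[R]_3) : Prop :=
  exists2 P, psd_sqrt (F *m F^T) P &
    char_poly P = \prod_(i < 3) ('X - (a 0 i)%:P).

Definition rotC (R : realType) (A Ul Ur : 'M[R]_3) : 'M[R]_3 :=
  Ul *m A *m Ur^T.

Definition is_svd (R : realType) (F A Ul Ur : 'M[R]_3) : Prop :=
  [/\ SO3 Ul, SO3 Ur, F = rotC A Ul Ur &
    exists2 a, singular_values F a & A = diag_mx a].

Definition diag3 (R : realType) (a1 a2 a3 : R) : 'M[R]_3 :=
  diag_mx (\row_(i < 3) [:: a1; a2; a3]`_i).

Definition calA (R : realType) : set 'M[R]_3 :=
  [set A | exists a1 a2 : R,
    [/\ 0 < a1, a2 < a1, a1 `^ (- 2^-1) < a2 & A = diag3 a1 a2 (a1 * a2)^-1]].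

Definition Q (R : realType) : set 'M[R]_3 :=
  [set F | SL3 F /\ exists2 a, singular_values F a & injective (a 0)].

Lemma rotC_Q (R : realType) (A Ul Ur : 'M[R]_3) :
  calA A -> SO3 Ul -> SO3 Ur -> Q (rotC A Ul Ur).
Proof.
move=> [a1 [a2 [a10 a21 a12 ->]]] [Ul1 dUl] [Ur1 dUr].
have p0 : 0 < a1 `^ (- 2^-1) by exact: powR_gt0.
have a20 : 0 < a2 by lra.
have p2 : a1 * (a1 `^ (- 2^-1)) ^+ 2 = 1.
  rewrite -powR_mulrn ?powR_ge0// -powRrM mulNr mulVf ?pnatr_eq0//.
  by rewrite powR_inv1 ?ltW// divff// gt_eqF.
have lt1 : 1 < a1 * a2 ^+ 2.
  by rewrite -p2 ltr_pM2l// ltrXn2r// ltW.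
have a120 : 0 < a1 * a2 by exact: mulr_gt0.
have a3i : (a1 * a2) * (a1 * a2)^-1 = 1 by rewrite divff// gt_eqF.
have a32 : (a1 * a2)^-1 < a2.
  by rewrite -(ltr_pM2l a120) a3i; rewrite expr2 mulrA in lt1.
have a30 : 0 < (a1 * a2)^-1 by rewrite invr_gt0.
rewrite /diag3; set a := \row_i _; set a3 := (a1 * a2)^-1 in a3i a32 a30 a *.
have age0 i : 0 <= a 0 i.
  by rewrite mxE; case: i => [[|[|[|k]]]]//= _; exact: ltW.
have UlT : Ul^T *m Ul = 1%:M by exact: mulmx1C.
have UrT : Ur^T *m Ur = 1%:M by exact: mulmx1C.
split.
  rewrite /SL3 /= /rotC !det_mulmx det_tr dUl dUr mul1r mulr1 det_diag.
  rewrite !big_ord_recl big_ord0 mulr1 !mxE/=.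
  by rewrite mulrA.
exists a.
  exists (Ul *m diag_mx a *m Ul^T).
    split.
    - by rewrite !trmx_mul trmxK tr_diag_mx mulmxA.
    - move=> v; have -> : v *m (Ul *m diag_mx a *m Ul^T) *m v^T =
          (v *m Ul) *m diag_mx a *m (v *m Ul)^T by rewrite trmx_mul !mulmxA.
      move: (v *m Ul) (a) age0 => w b bge0.
      rewrite mul_mx_diag !mxE sumr_ge0// => i _.
      by rewrite !mxE mulrAC -expr2 mulr_ge0 ?sqr_ge0.
    - rewrite /rotC !trmx_mul trmxK tr_diag_mx !mulmxA.
      by rewrite -(mulmxA _ Ul^T) UlT -(mulmxA _ Ur^T) UrT !mulmx1.
  have -> : char_poly (Ul *m diag_mx a *m Ul^T) = char_poly (diag_mx a).
    pose f := map_mx (@polyC R) : 'M[R]_3 -> _.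
    have ff : f Ul *m f Ul^T = 1%:M by rewrite -map_mxM Ul1 map_mx1.
    have -> : char_poly (Ul *m diag_mx a *m Ul^T) =
        \det (f Ul *m char_poly_mx (diag_mx a) *m f Ul^T).
      rewrite /char_poly /char_poly_mx mulmxBr mulmxBl scalar_mxC -(mulmxA 'X%:M) ff.
      by rewrite mulmx1 !map_mxM.
    rewrite !det_mulmx mulrAC -det_mulmx ff det1 mul1r//.
  rewrite char_poly_trig ?diag_mx_is_trig//.
  by apply: eq_bigr => i _; rewrite mxE eqxx.
move=> i j; rewrite !mxE.
by case: i => [[|[|[|]]]]//= ?; case: j => [[|[|[|]]]]//= ? E;
  apply/val_inj => //=; exfalso; lra.
Qed.

Lemma calC_subproof (R : realType)
    (x : (@calA R * @SO3 R * @SO3 R)%type) :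
  rotC (val x.1.1) (val x.1.2) (val x.2) \in @Q R.
Proof. by apply/mem_set/rotC_Q; apply/set_mem; exact: valP. Qed.

(* Sets coerce to subtypes, which carry the subset topology; the source carries
   the product topology. *)
Definition calC (R : realType)
    (x : (@calA R * @SO3 R * @SO3 R)%type) : @Q R :=
  exist _ (rotC (val x.1.1) (val x.1.2) (val x.2)) (calC_subproof x).

Definition potential (R : realType) (g : R) (a : 'rV[R]_3) : R :=
  - (2 * pi * g) *
  \int[lebesgue_measure]_(s in `[0%R, +oo[)
    ((\prod_(i < 3) (s + a 0 i ^+ 2)) `^ (- 2^-1)).

(* Partial derivatives in the three variables as independent ones, evaluated at
   the diagonal of A. *)
Definition dpotential (R : realType) (g : R) (A : 'M[R]_3) : 'M[R]_3 :=
  diag_mx (\row_(i < 3) 'D_(delta_mx 0 i) (potential g) (\row_j A j j)).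

(* I is meant to be open: derive1 is then determined by the values on I. *)
Definition twice_derivable_on (R : realType) (I : set R) (F : R -> 'M[R]_3) :
    Prop :=
  forall t, I t -> derivable F t 1 /\ derivable (derive1 F) t 1.

Definition angvel (R : realType) (U : R -> 'M[R]_3) (t : R) : 'M[R]_3 :=
  (U t)^T *m derive1 U t.

Definition riemann_solution (R : realType) (g : R) (I : set R)
    (A Ul Ur : R -> 'M[R]_3) : Prop :=
  [/\ (forall t, I t -> [/\ calA (A t), SO3 (Ul t) & SO3 (Ur t)]),
      [/\ twice_derivable_on I A, twice_derivable_on I Ul &
          twice_derivable_on I Ur] &
      forall t, I t ->
        let Ol := angvel Ul in
        let Or := angvel Ur in
        projF (A t)
          (derive1 (derive1 A) t
           + 2 *: (Ol t *m derive1 A t - derive1 A t *m Or t)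
           + (derive1 Ol t *m A t - A t *m derive1 Or t)
           + (Ol t *m Ol t *m A t - 2 *: (Ol t *m A t *m Or t)
              + A t *m Or t *m Or t)
           + dpotential g (A t)) = 0].

Definition dirichlet_solution (R : realType) (g : R) (I : set R)
    (F : R -> 'M[R]_3) : Prop :=
  [/\ (forall t, I t -> Q (F t)), twice_derivable_on I F &
      forall t, I t -> forall A Ul Ur : 'M[R]_3, is_svd (F t) A Ul Ur ->
        projF (F t) (derive1 (derive1 F) t + rotC (dpotential g A) Ul Ur) = 0].

(* Main.v *)
(* A singular value decomposition with decreasing singular values is unique up
   to U_l -> U_l D, U_r -> U_r D, with D diagonal of signs and determinant 1;
   there are four such D.  The singular values depend continuously on F (sign
   changes of det (F F^T - c^2) on either side of each of them isolate the
   roots), hence so do the spectral projectors of F F^T, which are quadratic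
   polynomials in F F^T.  Applying the projectors at F to the fixed columns of
   a frame U_0 and normalizing gives, near a given F_0, continuous columns of
   U_l; the sign pattern of the diagonal of U_0^T U_l labels the four sheets.
   For the equations of motion, F'' = U_l [...] U_r^T with [...] the inertial
   terms of Riemann's equation, the projection commutes with (U_l, U_r), and
   the gradient of the potential does not depend on the SVD because the
   potential is symmetric in the singular values. *)
Require Import Defs.
From HB Require Import structures.
From mathcomp Require Import all_boot all_order all_algebra.
From mathcomp Require Import fingroup perm.
From mathcomp Require Import zify ring lra.
From mathcomp Require Import all_classical all_reals all_analysis.

Set Implicit Arguments.
Unset Strict Implicit.
Unset Printing Implicit Defensive.

Import Order.TTheory GRing.Theory Num.Theory.
Import numFieldNormedType.Exports.

Local Open Scope classical_set_scope.
Local Open Scope ring_scope.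

(** * Singular value decompositions *)

Lemma SO3_trK (R : realType) (U : 'M[R]_3) : SO3 U -> U^T *m U = 1%:M.
Proof. by move=> [+ _]; exact: mulmx1C. Qed.

Lemma SO3_tr (R : realType) (U : 'M[R]_3) : SO3 U -> SO3 U^T.
Proof. by move=> U1; split; rewrite ?trmxK ?SO3_trK// det_tr; case: U1. Qed.

Lemma SO3_mul (R : realType) (U V : 'M[R]_3) : SO3 U -> SO3 V -> SO3 (U *m V).
Proof.
move=> [U1 dU] [V1 dV]; split; last by rewrite det_mulmx dU dV mulr1.
by rewrite trmx_mul mulmxA -(mulmxA U) V1 mulmx1.
Qed.

Lemma SO3_row_neq0 (R : realType) (U : 'M[R]_3) i : SO3 U ->
  exists j, U i j != 0.
Proof.
move=> [U1 _]; apply/existsP; apply: contraT; rewrite negb_exists => /forallP U0.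
have /matrixP/(_ i i) := U1; rewrite !mxE eqxx big1 => [/eqP|j _].
  by rewrite eq_sym oner_eq0.
by have /negPn/eqP -> := U0 j; rewrite mul0r.
Qed.

Lemma rotC_tr (R : realType) (A Ul Ur : 'M[R]_3) :
  (rotC A Ul Ur)^T = rotC A^T Ur Ul.
Proof. by rewrite /rotC !trmx_mul trmxK mulmxA. Qed.

(** Multiplication by [Vl^T] on the left and by [Ur] on the right leaves only the two transition
    matrices and the diagonal factors. *)
Lemma svd_compare_left (R : realType) (a b : 'rV[R]_3) (Ul Ur Vl Vr : 'M[R]_3) :
  SO3 Ur -> SO3 Vl ->
  rotC (diag_mx a) Ul Ur = rotC (diag_mx b) Vl Vr ->
  forall i j, (Vl^T *m Ul) i j * a 0 j = b 0 i * (Vr^T *m Ur) i j.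
Proof.
move=> Ur1 Vl1 E i j; have /(congr1 (fun M => Vl^T *m M *m Ur)) := E.
rewrite {1}/rotC -!mulmxA SO3_trK// mulmx1 mulmxA /rotC !mulmxA SO3_trK// mul1mx.
move=> /matrixP/(_ i j); rewrite -!mulmxA mulmxA mul_mx_diag mul_diag_mx !mxE.
by move=> ->.
Qed.

(** With [X] and [Y] the left and right transition matrices, the equation and its transpose give
    [X a = b Y] and [Y a = b X]. Hence each entry of [X - Y] is annihilated by some [a 0 j + b 0 i],
    which is positive. *)
Lemma svd_compare (R : realType) (a b : 'rV[R]_3) (Ul Ur Vl Vr : 'M[R]_3) :
  (forall i, 0 < a 0 i) -> (forall i, 0 <= b 0 i) ->
  SO3 Ul -> SO3 Ur -> SO3 Vl -> SO3 Vr ->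
  rotC (diag_mx a) Ul Ur = rotC (diag_mx b) Vl Vr ->
  Vl^T *m Ul = Vr^T *m Ur /\
  forall i j, (Vl^T *m Ul) i j != 0 -> b 0 i = a 0 j.
Proof.
move=> a0 b0 Ul1 Ur1 Vl1 Vr1 E.
have E1 := svd_compare_left Ur1 Vl1 E.
have E2 : forall i j, (Vr^T *m Ur) i j * a 0 j = b 0 i * (Vl^T *m Ul) i j.
  apply: svd_compare_left => //.
  by have := congr1 trmx E; rewrite !rotC_tr !tr_diag_mx.
have EXY : Vl^T *m Ul = Vr^T *m Ur.
  apply/matrixP => i j; have := E1 i j; have := E2 i j.
  move: ((Vl^T *m Ul) i j) ((Vr^T *m Ur) i j) => x y Ey Ex.
  have : (x - y) * (a 0 j + b 0 i) = 0.
    by rewrite mulrDr !mulrBl Ex Ey; ring.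
  move/eqP; rewrite mulf_eq0 subr_eq0 (gt_eqF (ltr_wpDr _ _)) ?orbF//.
  by move/eqP.
split=> // i j X0; have := E1 i j; rewrite -EXY mulrC => /(mulIf X0) ->//.
Qed.

(** A nonzero entry of the transition matrix matches a [b 0 i] with an [a 0 j]; as the [a 0 j] are
    distinct, each row has only one such entry. Since [b] may come in any order, every singular
    value decomposition is covered. *)
Lemma svd_perm (R : realType) (a b : 'rV[R]_3) (Ul Ur Vl Vr : 'M[R]_3) :
  (forall i, 0 < a 0 i) -> injective (a 0) -> (forall i, 0 <= b 0 i) ->
  SO3 Ul -> SO3 Ur -> SO3 Vl -> SO3 Vr ->
  rotC (diag_mx a) Ul Ur = rotC (diag_mx b) Vl Vr ->
  exists s : 'S_3, (forall i, b 0 i = a 0 (s i)) /\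
    forall i j, (Vl^T *m Ul) i j != 0 -> j = s i.
Proof.
move=> a0 ainj b0 Ul1 Ur1 Vl1 Vr1 E.
have [_ ba] := svd_compare a0 b0 Ul1 Ur1 Vl1 Vr1 E.
have X1 : SO3 (Vl^T *m Ul) by apply: SO3_mul => //; exact: SO3_tr.
have /choice[f fX] := fun i => SO3_row_neq0 i X1.
have /choice[h hX] := fun i => SO3_row_neq0 i (SO3_tr X1).
have fE i : b 0 i = a 0 (f i) by exact: ba.
(* A nonzero entry in each column provides a right inverse of [f]; on a finite set [f] is then a
   bijection. *)
have hK : cancel h f.
  by move=> j; apply: ainj; rewrite -fE; apply: ba; have := hX j; rewrite mxE.
have finj := can_inj (canF_sym hK).
exists (perm finj); split=> i; first by rewrite permE.
by move=> j Xij; apply: ainj; rewrite permE -fE; symmetry; exact: ba.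
Qed.

Definition decr3 (R : realType) (a : 'rV[R]_3) : Prop :=
  forall i j : 'I_3, (i < j)%N -> a 0 j < a 0 i.

Lemma decr3_inj (R : realType) (a : 'rV[R]_3) : decr3 a -> injective (a 0).
Proof.
move=> ad i j aij; apply/val_inj; case: (ltngtP i j) => // /ad.
  by rewrite aij ltxx.
by rewrite aij ltxx.
Qed.

(** Such an [s] is strictly increasing, and the only increasing permutation is the identity. *)
Lemma decr3_perm (R : realType) (a b : 'rV[R]_3) (s : 'S_3) :
  decr3 a -> decr3 b -> (forall i, b 0 i = a 0 (s i)) -> s = 1%g.
Proof.
move=> ad bd ba.
have smono (i j : 'I_3) : (i < j)%N -> (s i < s j)%N.
  move=> ij; rewrite ltnNge leq_eqVlt; apply/negP => /predU1P[/val_inj E|/ad].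
    by move: ij; rewrite (perm_inj E) ltnn.
  by rewrite -!ba ltNge => /negP; apply; exact/ltW/bd.
apply/permP => i; rewrite perm1; apply/val_inj.
pose i1 : 'I_3 := Ordinal (isT : (1 < 3)%N).
pose i2 : 'I_3 := Ordinal (isT : (2 < 3)%N).
have s01 : (s ord0 < s i1)%N by exact: smono.
have s12 : (s i1 < s i2)%N by exact: smono.
have s2 := ltn_ord (s i2).
have E (j : 'I_3) : i = j -> val (s j) = val j -> val (s i) = val i.
  by move=> ->.
case: i E => [[|[|[|//]]] i3] E.
- by apply: (E ord0); [exact/val_inj|rewrite /=; lia].
- by apply: (E i1); [exact/val_inj|rewrite /=; lia].
- by apply: (E i2); [exact/val_inj|rewrite /=; lia].
Qed.

Lemma decr3_sort (R : realType) (a : 'rV[R]_3) : injective (a 0) ->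
  exists s : 'I_3 -> 'I_3, decr3 (\row_i a 0 (s i)).
Proof.
move=> ainj; pose r := [rel i j : 'I_3 | a 0 j <= a 0 i].
have rtot : total r by move=> i j; exact: le_total.
have rtr : transitive r by move=> j i k /= ij jk; exact: le_trans jk ij.
pose l := sort r (enum 'I_3).
have sl : size l = 3%N by rewrite size_sort size_enum_ord.
have ul : uniq l by rewrite sort_uniq enum_uniq.
exists (fun i : 'I_3 => nth ord0 l i) => i j ij; rewrite !mxE lt_neqAle.
apply/andP; split.
  apply/negP => /eqP/ainj/eqP; rewrite nth_uniq ?sl ?ltn_ord//.
  by rewrite gtn_eqF.
have := sort_sorted rtot (enum 'I_3); rewrite (sorted_pairwise rtr).
by move/(pairwiseP ord0); apply; rewrite ?inE -/l ?sl.
Qed.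

(** * Existence and uniqueness of ordered singular value decompositions *)

Lemma dotmx_gt0 (R : realDomainType) n (v : 'rV[R]_n) :
  v != 0 -> 0 < (v *m v^T) 0 0.
Proof.
move=> v0; have sq (i : 'I_n) : true -> 0 <= v 0 i * v^T i 0.
  by move=> _; rewrite mxE -expr2 sqr_ge0.
rewrite mxE lt_neqAle sumr_ge0// andbT eq_sym psumr_eq0//.
apply: contra v0 => /allP v0; apply/eqP/rowP => i; rewrite mxE.
by have := v0 i (mem_index_enum _); rewrite mxE mulf_eq0 orbb => /eqP.
Qed.

Lemma psd_eigenvalue_ge0 (R : realType) (S P : 'M[R]_3) (c : R) :
  psd_sqrt S P -> root (char_poly P) c -> 0 <= c.
Proof.
move=> [_ P0 _]; rewrite -eigenvalue_root_char => /eigenvalueP[v vP v0].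
have vv := dotmx_gt0 v0.
by have := P0 v; rewrite vP -scalemxAl mxE pmulr_lge0.
Qed.

(** The product of the [a 0 i] is [\det P], whose square is [\det (F *m F^T) = 1]. All [a 0 i] are
    nonnegative as eigenvalues of [P], so the product is 1 and no factor vanishes. *)
Lemma singular_valuesP (R : realType) (F : 'M[R]_3) (a : 'rV[R]_3) :
  singular_values F a -> \det F = 1 -> 
  (forall i, 0 < a 0 i) /\ \prod_(i < 3) a 0 i = 1.
Proof.
move=> [P PS cP] dF.
have ar i : root (char_poly P) (a 0 i).
  by rewrite cP (bigD1 i)//= rootM root_XsubC eqxx.
have a0 i : 0 <= a 0 i by exact: (psd_eigenvalue_ge0 PS).
have dP : \det P = \prod_(i < 3) a 0 i.
  have := char_poly_det P; rewrite cP -horner_coef0 horner_prod.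
  under eq_bigr do rewrite hornerXsubC sub0r.
  by rewrite prodrN card_ord => /(mulrI _)<-//; rewrite unitrX// unitrN1.
have dP1 : \prod_(i < 3) a 0 i = 1.
  have [_ _ /(congr1 determinant)] := PS.
  rewrite !det_mulmx det_tr dF mulr1 -expr2 => /eqP.
  by rewrite -dP sqrp_eq1 ?dP ?prodr_ge0// => /eqP.
split=> // i; rewrite lt_neqAle a0 andbT; apply/eqP => ai.
by move: dP1; rewrite (bigD1 i)//= -ai mul0r => /eqP; rewrite eq_sym oner_eq0.
Qed.

Lemma orthonormal_eigenbasis (R : realType) (P : 'M[R]_3) (a : 'rV[R]_3) :
  P^T = P -> injective (a 0) -> (forall i, root (char_poly P) (a 0 i)) ->
  exists2 U, SO3 U & P = U *m diag_mx a *m U^T.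
Proof.
move=> PT ainj ar.
have /choice[v vP] : forall i, exists v : 'rV[R]_3,
    v *m P = a 0 i *: v /\ (v *m v^T) 0 0 = 1.
  move=> i; have := ar i; rewrite -eigenvalue_root_char => /eigenvalueP[v vP v0].
  have vv := dotmx_gt0 v0.
  exists ((Num.sqrt ((v *m v^T) 0 0))^-1 *: v); split.
    by rewrite -scalemxAl vP !scalerA mulrC.
  rewrite linearZ/= -scalemxAl -scalemxAr scalerA mxE -invfM -expr2 sqr_sqrtr ?ltW//.
  by rewrite mulVf// gt_eqF.
pose M : 'M[R]_3 := \matrix_i v i.
have MP : M *m P = diag_mx a *m M.
  apply/row_matrixP => i; rewrite row_mul rowK (vP i).1; apply/rowP => j.
  by rewrite [RHS]mxE mul_diag_mx !mxE.
have MM : M *m M^T = 1%:M.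
  apply/matrixP => i j; rewrite [RHS]mxE; case: eqVneq => [->|ij].
    have := (vP j).2; rewrite -(rowK v j) -/M -row_mul tr_row => <-.
    by rewrite !mxE; apply: eq_bigr => k _; rewrite !mxE.
  (* Symmetry of [M *m P *m M^T] makes [M *m M^T] commute with [diag_mx a]; distinct diagonal
     entries then kill its off-diagonal entries. *)
  have : diag_mx a *m (M *m M^T) = M *m M^T *m diag_mx a.
    have sP : (M *m P *m M^T)^T = M *m P *m M^T.
      by rewrite !trmx_mul trmxK PT mulmxA.
    by rewrite mulmxA -MP -sP MP !trmx_mul tr_diag_mx trmxK mulmxA.
  move/matrixP/(_ i j); rewrite mul_mx_diag mul_diag_mx !mxE => /eqP.
  rewrite mulrC -subr_eq0 -mulrBr mulf_eq0 subr_eq0.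
  by case/orP => /eqP // /ainj/eqP; rewrite (negPf ij).
have dM : \det M ^+ 2 = 1.
  by have := congr1 determinant MM; rewrite det_mulmx det_tr det1.
(* The factor [\det M] is 1 or -1. It corrects the determinant because the dimension is odd, and it
   cancels in the conjugation. *)
exists (\det M *: M^T).
  split; last by rewrite detZ det_tr -exprSr (exprM _ 2 2) dM expr1n.
  by rewrite linearZ/= -scalemxAl -scalemxAr scalerA -expr2 dM scale1r trmxK mulmx1C.
rewrite linearZ/= -!scalemxAl -scalemxAr scalerA -expr2 dM scale1r trmxK.
by rewrite -mulmxA -MP mulmxA (mulmx1C MM) mul1mx.
Qed.

Lemma calAP (R : realType) (A : 'M[R]_3) :
  calA A <-> exists a : 'rV[R]_3,
    [/\ A = diag_mx a, decr3 a, forall i, 0 < a 0 i & \prod_(i < 3) a 0 i = 1].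
Proof.
have half_inv (x : R) : 0 < x -> x * (x `^ (- 2^-1)) ^+ 2 = 1.
  move=> x0; rewrite -powR_mulrn ?powR_ge0// -powRrM mulNr mulVf ?pnatr_eq0//.
  by rewrite powR_inv1 ?ltW// divff// gt_eqF.
split=> [[a1 [a2 [a10 a21 a12 ->]]]|[a [-> ad a0]]].
  have p0 : 0 < a1 `^ (- 2^-1) by exact: powR_gt0.
  have a20 : 0 < a2 by lra.
  have a120 : 0 < a1 * a2 by exact: mulr_gt0.
  have lt1 : 1 < a1 * a2 ^+ 2.
    by rewrite -(half_inv a1 a10) ltr_pM2l// ltrXn2r// ltW.
  have a32 : (a1 * a2)^-1 < a2.
    by rewrite -(ltr_pM2l a120) divff ?gt_eqF// -mulrA -expr2.
  have a30 : 0 < (a1 * a2)^-1 by rewrite invr_gt0.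
  exists (\row_(i < 3) [:: a1; a2; (a1 * a2)^-1]`_i); split=> //.
  - by move=> [[|[|[|?]]] ?] [[|[|[|?]]] ?]//= _; rewrite !mxE//=; lra.
  - by move=> [[|[|[|?]]] ?]//=; rewrite !mxE.
  - by rewrite !big_ord_recl big_ord0 !mxE/= mulr1 mulrA divff// gt_eqF.
pose i1 : 'I_3 := Ordinal (isT : (1 < 3)%N).
pose i2 : 'I_3 := Ordinal (isT : (2 < 3)%N).
have -> : \prod_(i < 3) a 0 i = a 0 ord0 * a 0 i1 * a 0 i2.
  rewrite !big_ord_recl big_ord0 mulr1 mulrA.
  by congr (_ * a 0 _ * a 0 _); exact/val_inj.
move=> a1; have a12i : a 0 i2 = (a 0 ord0 * a 0 i1)^-1.
  have a01 : a 0 ord0 * a 0 i1 != 0 by rewrite gt_eqF// mulr_gt0.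
  by apply: (mulfI a01); rewrite a1 divff.
exists (a 0 ord0), (a 0 i1); split=> //.
- exact: ad.
- have p0 : 0 < (a 0 ord0) `^ (- 2^-1) by exact: powR_gt0.
  rewrite -(ltr_pXn2r (ltn0Sn 1)) ?nnegrE ?ltW// -(ltr_pM2l (a0 ord0)) half_inv//.
  by rewrite -a1 expr2 mulrA ltr_pM2l ?mulr_gt0//; exact: ad.
- rewrite /diag3; congr diag_mx; apply/rowP => i; rewrite mxE -a12i.
  by case: i => [[|[|[|//]]] ?] /=; congr (a 0 _); exact/val_inj.
Qed.

(** The left factor diagonalizes the square root of [F *m F^T] with its eigenvalues in decreasing
    order; the right factor is then determined by [F]. *)
Lemma Q_svd (R : realType) (F : 'M[R]_3) : Q F ->
  exists A Ul Ur, [/\ calA A, SO3 Ul, SO3 Ur & F = rotC A Ul Ur].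
Proof.
move=> [dF [a Fa ainj]]; have [a0 a1] := singular_valuesP Fa dF.
have [P [PT P0 PP] cP] := Fa.
have [s sd] := decr3_sort ainj; pose b : 'rV[R]_3 := \row_i a 0 (s i).
have sinj : injective s.
  move=> i j sij; apply: (decr3_inj sd); by rewrite !mxE sij.
have b0 i : 0 < b 0 i by rewrite mxE.
have b1 : \prod_(i < 3) b 0 i = 1.
  rewrite -[RHS]a1 [RHS](reindex_inj sinj) /=.
  by apply: eq_bigr => i _; rewrite mxE.
have br i : root (char_poly P) (b 0 i).
  by rewrite mxE cP (bigD1 (s i))//= rootM root_XsubC eqxx.
have [U U1 PE] := orthonormal_eigenbasis PT (decr3_inj sd) br.
have dbU : diag_mx b \in unitmx.
  by rewrite unitmxE det_diag b1 unitr1.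
(* Obtained by solving [F = U *m diag_mx b *m V^T] for [V]. It is orthogonal because [U]
   diagonalizes [F *m F^T] to the square of [diag_mx b]. *)
pose V := F^T *m U *m invmx (diag_mx b).
have UTU := SO3_trK U1.
have FFU : U^T *m (F *m F^T) *m U = diag_mx b *m diag_mx b.
  rewrite -PP PE !mulmxA UTU mul1mx -(mulmxA _ U^T) UTU mulmx1.
  by rewrite -(mulmxA _ U^T) UTU mulmx1.
have V1 : V^T *m V = 1%:M.
  rewrite /V !trmx_mul trmxK trmx_inv tr_diag_mx !mulmxA.
  rewrite -(mulmxA _ F) -(mulmxA _ _ (F *m _)) -(mulmxA _ _ U) FFU.
  by rewrite mulmxA mulVmx// mul1mx mulmxV.
exists (diag_mx b), U, V; split=> //.
- by apply/calAP; exists b.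
- split; first exact: mulmx1C.
  rewrite /V !det_mulmx det_tr dF det_inv det_diag b1 invr1.
  by case: U1 => _ ->; rewrite !mulr1.
- rewrite /rotC /V !trmx_mul trmxK trmx_inv tr_diag_mx.
  rewrite !mulmxA -(mulmxA U) mulmxV// mulmx1.
  by case: U1 => -> _; rewrite mul1mx.
Qed.

(** With both diagonals decreasing, the permutation of [svd_perm] is trivial. This describes the
    fibres of [calC]. *)
Lemma svd_sorted_unique (R : realType) (A B Ul Ur Vl Vr : 'M[R]_3) :
  calA A -> calA B -> SO3 Ul -> SO3 Ur -> SO3 Vl -> SO3 Vr ->
  rotC A Ul Ur = rotC B Vl Vr ->
  [/\ A = B, forall i j, i != j -> (Vl^T *m Ul) i j = 0 &
    Vl^T *m Ul = Vr^T *m Ur].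
Proof.
move=> /calAP[a [-> ad a0 _]] /calAP[b [-> bd b0 _]] Ul1 Ur1 Vl1 Vr1 E.
have bge0 i := ltW (b0 i).
have [s [ba sX]] := svd_perm a0 (decr3_inj ad) bge0 Ul1 Ur1 Vl1 Vr1 E.
have s1 := decr3_perm ad bd ba.
have [EX _] := svd_compare a0 bge0 Ul1 Ur1 Vl1 Vr1 E.
split=> //; first by congr diag_mx; apply/rowP => i; rewrite ba s1 perm1.
move=> i j ij; apply/eqP; apply: contraNT ij => /sX ->.
by rewrite s1 perm1.
Qed.

(** * Symmetry of the potential and rotation invariance of the projection *)

Lemma potential_perm (R : realType) (g : R) (s : 'S_3) (a : 'rV[R]_3) :
  potential g (col_perm s a) = potential g a.
Proof.
apply: (congr1 (fun z : R => - (2 * pi * g) * z)).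
apply: eq_Rintegral => x _; congr (_ `^ _).
by rewrite [RHS](reindex_perm s); apply: eq_bigr => i _; rewrite mxE.
Qed.

Lemma derive_potential_perm (R : realType) (g : R) (s : 'S_3) (a : 'rV[R]_3) i :
  'D_(delta_mx 0 i) (potential g) (col_perm s a) =
  'D_(delta_mx 0 (s i)) (potential g) a.
Proof.
pose d (v b : 'rV[R]_3) (h : R) :=
  h^-1 *: (potential g (h *: v + b) - potential g b).
(* The difference quotients already agree as functions of [h], hence so do their limits. *)
suff dE : d (delta_mx 0 i) (col_perm s a) = d (delta_mx 0 (s i)) a.
  exact: (congr1 (fun f : R -> R => lim (f @ 0^'))).
apply/funext => h; rewrite /d potential_perm.
have -> : h *: delta_mx 0 i + col_perm s a =
    col_perm s (h *: delta_mx 0 (s i) + a) :> 'rV[R]_3.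
  by apply/rowP => j; rewrite !mxE (inj_eq perm_inj).
by rewrite potential_perm.
Qed.

Lemma dpotential_diag (R : realType) (g : R) (a : 'rV[R]_3) :
  dpotential g (diag_mx a) =
  diag_mx (\row_i 'D_(delta_mx 0 i) (potential g) a).
Proof.
rewrite /dpotential; suff -> : \row_j diag_mx a j j = a by [].
by apply/rowP => j; rewrite !mxE eqxx.
Qed.

(** Converse of [svd_compare_left]; it is applied to the diagonals of the gradients rather than to
    the singular values. *)
Lemma rotC_diag_eq (R : realType) (p q : 'I_3 -> R) (Ul Ur Vl Vr : 'M[R]_3) :
  SO3 Vl -> SO3 Ur ->
  (forall i j, (Vl^T *m Ul) i j * q j = p i * (Vr^T *m Ur) i j) ->
  rotC (diag_mx (\row_i p i)) Vl Vr = rotC (diag_mx (\row_i q i)) Ul Ur.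
Proof.
move=> [VlT _] [UrT _] pq.
have {}pq : (Vl^T *m Ul) *m diag_mx (\row_i q i) =
    diag_mx (\row_i p i) *m (Vr^T *m Ur).
  apply/matrixP => i j; rewrite mul_mx_diag mul_diag_mx mxE [X in _ * X]mxE pq.
  by rewrite [RHS]mxE [X in _ = X * _]mxE.
rewrite /rotC -[LHS]mulmx1 -UrT !mulmxA -(mulmxA _ Vr^T) -(mulmxA Vl) -pq.
by rewrite !mulmxA VlT mul1mx.
Qed.

(** The transition matrix is supported on the graph of a permutation [s], and the partial
    derivatives are permuted by the same [s]. So it intertwines the two gradients just as it
    intertwines the singular values. *)
Lemma dpotential_svd (R : realType) (g : R) (A B Ul Ur Vl Vr : 'M[R]_3) :
  calA A -> SO3 Ul -> SO3 Ur -> is_svd (rotC A Ul Ur) B Vl Vr ->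
  rotC (dpotential g B) Vl Vr = rotC (dpotential g A) Ul Ur.
Proof.
move=> AA Ul1 Ur1 [Vl1 Vr1 E [b Fb EB]].
have [dF _] := rotC_Q AA Ul1 Ur1.
have [b0 _] := singular_valuesP Fb dF.
have /calAP[a [EA ad a0 _]] := AA; subst A B.
have bge0 i := ltW (b0 i).
have [s [ba sX]] := svd_perm a0 (decr3_inj ad) bge0 Ul1 Ur1 Vl1 Vr1 E.
have [EX _] := svd_compare a0 bge0 Ul1 Ur1 Vl1 Vr1 E.
have {ba}-> : b = col_perm s a by apply/rowP => i; rewrite ba mxE.
rewrite !dpotential_diag; apply: rotC_diag_eq => // i j.
rewrite -EX; have [->|/sX ->] := eqVneq ((Vl^T *m Ul) i j) 0.
  by rewrite mul0r mulr0.
by rewrite derive_potential_perm mulrC.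
Qed.

Lemma invmx_rotC (R : realType) (A Ul Ur : 'M[R]_3) :
  A \in unitmx -> SO3 Ul -> SO3 Ur ->
  (invmx (rotC A Ul Ur))^T = rotC (invmx A)^T Ul Ur.
Proof.
move=> Au Ul1 Ur1; have UrT := SO3_trK Ur1; have [UlT _] := Ul1.
have E : rotC A Ul Ur *m rotC (invmx A) Ur Ul = 1%:M.
  rewrite /rotC !mulmxA -(mulmxA _ Ur^T) UrT mulmx1.
  by rewrite -(mulmxA Ul) mulmxV// mulmx1.
have [Fu _] := mulmx1_unit E.
rewrite -rotC_tr; congr trmx.
by rewrite -[LHS]mulmx1 -E mulmxA mulVmx// mul1mx.
Qed.

(** The trace inner product is invariant under rotations on both sides, and the inverse transpose is
    equivariant by [invmx_rotC]. *)
Lemma projF_rotC (R : realType) (A G Ul Ur : 'M[R]_3) :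
  A \in unitmx -> SO3 Ul -> SO3 Ur ->
  projF (rotC A Ul Ur) (rotC G Ul Ur) = rotC (projF A G) Ul Ur.
Proof.
move=> Au Ul1 Ur1; rewrite /projF invmx_rotC//.
have -> : mxdot (rotC G Ul Ur) (rotC A Ul Ur) = mxdot G A.
  rewrite /mxdot rotC_tr {1}/rotC /rotC !mulmxA -(mulmxA _ Ur^T) SO3_trK//.
  by rewrite mulmx1 mxtrace_mulC !mulmxA SO3_trK// mul1mx.
by rewrite /rotC mulmxBr mulmxBl -scalemxAr -scalemxAl.
Qed.

(** * From Riemann's to Dirichlet's equation *)

Lemma is_derive_mxP (R : realType) m n (M : R -> 'M[R]_(m, n)) (t : R) dM :
  is_derive t 1 M dM <-> forall i j, is_derive t 1 (fun x => M x i j) (dM i j).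
Proof.
split=> [[Md MD] i j|MD].
  split; first by move/derivable_mxP : Md; apply.
  by rewrite -MD derive_mx// mxE.
have Md : derivable M t 1 by apply/derivable_mxP => i j; have [] := MD i j.
split=> //; rewrite derive_mx//; apply/matrixP => i j; rewrite mxE.
by have [] := MD i j.
Qed.

Lemma is_derive_mulmx (R : realType) m n p (M : R -> 'M[R]_(m, n))
    (N : R -> 'M[R]_(n, p)) (t : R) dM dN :
  is_derive t 1 M dM -> is_derive t 1 N dN ->
  is_derive t 1 (fun x => M x *m N x) (dM *m N t + M t *m dN).
Proof.
move=> /is_derive_mxP MD /is_derive_mxP ND; apply/is_derive_mxP => i j.
rewrite (_ : (fun x => (M x *m N x) i j) =
    \sum_(k < n) (fun x => M x i k) * (fun x => N x k j)); last first.
  by apply/funext => x; rewrite mxE fct_sumE.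
apply: is_derive_eq; rewrite !mxE -big_split/=; apply: eq_bigr => k _.
by rewrite addrC /GRing.scale/=; congr (_ + _); rewrite mulrC.
Qed.

Lemma is_derive_trmx (R : realType) m n (M : R -> 'M[R]_(m, n)) (t : R) dM :
  is_derive t 1 M dM -> is_derive t 1 (fun x => (M x)^T) dM^T.
Proof.
move=> /is_derive_mxP MD; apply/is_derive_mxP => i j.
rewrite mxE; under eq_fun do rewrite mxE; exact: MD.
Qed.

Lemma is_derive1 (R : realType) (V : normedModType R) (M : R -> V) (t : R) :
  derivable M t 1 -> is_derive t 1 M (derive1 M t).
Proof. by move=> ?; split=> //; rewrite derive1E. Qed.

(** The constraints and formulas for the curves hold only at times in [I]; openness turns them into
    identities near [t], which may be differentiated. *)
Lemma open_eq_is_derive (R : realType) (V : normedModType R) (I : set R)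
    (f h : R -> V) (t : R) dh :
  open I -> I t -> (forall x, I x -> f x = h x) ->
  is_derive t 1 h dh -> is_derive t 1 f dh.
Proof.
move=> Io It fh; apply: near_eq_is_derive.
by apply: filterS (open_nbhs_nbhs (conj Io It)) => x Ix; rewrite fh.
Qed.

Lemma angvelE (R : realType) (U : R -> 'M[R]_3) (t : R) :
  SO3 (U t) -> derive1 U t = U t *m angvel U t.
Proof. by move=> [UU _]; rewrite /angvel mulmxA UU mul1mx. Qed.

(** Differentiate [U^T *m U = 1%:M]. *)
Lemma angvel_skew (R : realType) (I : set R) (U : R -> 'M[R]_3) (t : R) :
  open I -> I t -> (forall x, I x -> SO3 (U x)) -> derivable U t 1 ->
  (angvel U t)^T = - angvel U t.
Proof.
move=> Io It U1 /is_derive1 UD.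
have [_ E] : is_derive t 1 (fun x => (U x)^T *m U x) 0.
  apply: (open_eq_is_derive (h := fun=> 1%:M) Io It) => x Ix.
  exact/SO3_trK/U1.
have [_] := is_derive_mulmx (is_derive_trmx UD) UD.
rewrite E /angvel trmx_mul trmxK => /eqP.
by rewrite eq_sym addr_eq0 => /eqP.
Qed.

Lemma is_derive_angvel (R : realType) (U : R -> 'M[R]_3) (t : R) :
  derivable U t 1 -> derivable (derive1 U) t 1 ->
  is_derive t 1 (angvel U) (derive1 (angvel U) t).
Proof.
move=> /is_derive1 U1 /is_derive1 U2; apply: is_derive1.
by have [] := is_derive_mulmx (is_derive_trmx U1) U2.
Qed.

(** Derivative in the rotating frames: [Ul' = Ul *m Ol] and, by skewness, the derivative of [Ur^T]
    is [- Or *m Ur^T]. The curve [A] is arbitrary, so that the rule can be applied again to the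
    first derivative. *)
Lemma is_derive_rotC (R : realType) (I : set R) (A Ul Ur : R -> 'M[R]_3)
    (t : R) dA :
  open I -> I t -> (forall x, I x -> SO3 (Ul x)) ->
  (forall x, I x -> SO3 (Ur x)) -> derivable Ul t 1 -> derivable Ur t 1 ->
  is_derive t 1 A dA ->
  is_derive t 1 (fun x => rotC (A x) (Ul x) (Ur x))
    (rotC (angvel Ul t *m A t + dA - A t *m angvel Ur t) (Ul t) (Ur t)).
Proof.
move=> Io It Ul1 Ur1 Uld Urd AD.
have /is_derive1 UlD := Uld; have /is_derive1/is_derive_trmx UrD := Urd.
have := is_derive_mulmx (is_derive_mulmx UlD AD) UrD.
move=> D; apply: (is_derive_eq D).
rewrite !angvelE; [|exact: Ur1|exact: Ul1].
rewrite trmx_mul (angvel_skew Io It Ur1 Urd) /rotC !mulmxDr !mulmxDl !mulmxA.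
by rewrite !(mulmxN, mulNmx) !mulmxA.
Qed.

(** The left side is the operation [X |-> Ol X + X' - X Or] applied twice to [A]; the right side is
    the inertial part of Riemann's equation. *)
Lemma second_derivative_body_frame (R : realType) n
    (A A1 A2 Ol Or Ol1 Or1 : 'M[R]_n) :
  let M := Ol *m A + A1 - A *m Or in
  Ol *m M + (Ol1 *m A + Ol *m A1 + A2 - (A1 *m Or + A *m Or1)) - M *m Or =
  A2 + 2 *: (Ol *m A1 - A1 *m Or) + (Ol1 *m A - A *m Or1)
  + (Ol *m Ol *m A - 2 *: (Ol *m A *m Or) + A *m Or *m Or).
Proof.
rewrite /= !(mulmxDl, mulmxDr, mulmxN, mulNmx) !mulmxA.
move: (Ol *m Ol *m A) (Ol *m A *m Or) (A *m Or *m Or) (Ol *m A1) (A1 *m Or).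
move: (Ol1 *m A) (A *m Or1) => x1 x2 x3 x4 x5 x6 x7.
apply/matrixP => i j; rewrite !mxE; ring.
Qed.

Lemma riemann_dirichlet (R : realType) (g : R) (I : set R)
    (A Ul Ur : R -> 'M[R]_3) :
  open I -> riemann_solution g I A Ul Ur ->
  dirichlet_solution g I (fun t => rotC (A t) (Ul t) (Ur t)).
Proof.
move=> Io [IX [dA dUl dUr] eqn].
have Al t : I t -> calA (A t) by move=> /IX[].
have Ul1 t : I t -> SO3 (Ul t) by move=> /IX[].
have Ur1 t : I t -> SO3 (Ur t) by move=> /IX[].
pose F t := rotC (A t) (Ul t) (Ur t).
(* [M] is the velocity of [F] seen in the rotating frames, and [dM] below is its derivative by the
   product rule. *)
pose M t := angvel Ul t *m A t + derive1 A t - A t *m angvel Ur t.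
have F1 t : I t -> is_derive t 1 F (rotC (M t) (Ul t) (Ur t)).
  move=> It; have [Ad _] := dA t It.
  have [[Uld _] [Urd _]] := (dUl t It, dUr t It).
  exact: (is_derive_rotC Io It Ul1 Ur1 Uld Urd (is_derive1 Ad)).
pose dM t := derive1 (angvel Ul) t *m A t + angvel Ul t *m derive1 A t +
  derive1 (derive1 A) t -
  (derive1 A t *m angvel Ur t + A t *m derive1 (angvel Ur) t).
have MD t : I t -> is_derive t 1 M (dM t).
  move=> It; have AD := is_derive1 (dA t It).1.
  have UlD := is_derive_angvel (dUl t It).1 (dUl t It).2.
  have UrD := is_derive_angvel (dUr t It).1 (dUr t It).2.
  have D1 := is_deriveD (is_derive_mulmx UlD AD) (is_derive1 (dA t It).2).
  have D := is_deriveB D1 (is_derive_mulmx AD UrD).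
  exact: D.
have F2 t : I t -> is_derive t 1 (derive1 F)
    (rotC (angvel Ul t *m M t + dM t - M t *m angvel Ur t) (Ul t) (Ur t)).
  move=> It; apply: (open_eq_is_derive
      (h := fun x => rotC (M x) (Ul x) (Ur x)) Io It) => [x Ix|].
    by rewrite derive1E; have [_] := F1 x Ix.
  have [[Uld _] [Urd _]] := (dUl t It, dUr t It).
  exact: (is_derive_rotC Io It Ul1 Ur1 Uld Urd (MD t It)).
split=> [t It|t It|t It B Vl Vr BV].
- by apply: rotC_Q; [exact: Al|exact: Ul1|exact: Ur1].
- by split; [have [] := F1 t It|have [] := F2 t It].
(* The arbitrary decomposition of [F t] is exchanged for the one given by the curves. *)
rewrite (dpotential_svd _ (Al t It) (Ul1 t It) (Ur1 t It) BV).
have [_ F2E] := F2 t It.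
rewrite -/F derive1E F2E /rotC -mulmxDl -mulmxDr.
have Au : A t \in unitmx.
  have [a [-> _ _ a1]] := (calAP (A t)).1 (Al t It).
  by rewrite unitmxE det_diag a1 unitr1.
(* The rotations are pulled out of the projection; what remains inside is the left side of Riemann's
   equation. *)
rewrite -/(rotC _ _ _) -/(rotC _ _ _) projF_rotC//; [|exact: Ul1|exact: Ur1].
rewrite (_ : projF _ _ = 0); first by rewrite /rotC mulmx0 mul0mx.
rewrite -[RHS](eqn t It)/=.
by rewrite -second_derivative_body_frame.
Qed.

(** * Continuity of singular values and spectral projectors *)

Lemma cvg_mx (R : realType) m n (T : Type) (F : set_system T) {FF : Filter F}
    (f : T -> 'M[R]_(m, n)) (l : 'M[R]_(m, n)) :
  (forall i j, f x i j @[x --> F] --> l i j) -> f @ F --> l.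
Proof.
move=> fl A [P lP sPA]; rewrite nbhs_simpl/=.
apply: (@filterS _ _ _ [set x | forall i j, P i j (f x i j)]) => [x Px|].
  exact: sPA.
by apply: filter_forall => i; apply: filter_forall => j; exact: fl (lP i j).
Qed.

Lemma cvg_coord (R : realType) m n (T : Type) (F : set_system T) {FF : Filter F}
    (f : T -> 'M[R]_(m, n)) (l : 'M[R]_(m, n)) i j :
  f @ F --> l -> f x i j @[x --> F] --> l i j.
Proof.
move=> fl; exact: (cvg_comp f (fun M : 'M[R]_(m, n) => M i j) fl
  (@coord_continuous R m n i j l)).
Qed.

Lemma cvg_sum (R : realType) (T : Type) (F : set_system T) {FF : Filter F}
    (I : finType) (f : I -> T -> R) (l : I -> R) :
  (forall i, f i @ F --> l i) -> \sum_i f i x @[x --> F] --> \sum_i l i.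
Proof.
move=> fl.
exact: (cvg_big (P := xpredT) (@add_continuous R) _ (fun i _ => fl i)).
Qed.

Lemma cvg_prod (R : realType) (T : Type) (F : set_system T) {FF : Filter F}
    (I : finType) (f : I -> T -> R) (l : I -> R) :
  (forall i, f i @ F --> l i) -> \prod_i f i x @[x --> F] --> \prod_i l i.
Proof.
move=> fl.
exact: (cvg_big (P := xpredT) (@mul_continuous R) _ (fun i _ => fl i)).
Qed.

Lemma cvg_mulmx (R : realType) m n p (T : Type) (F : set_system T)
    {FF : Filter F} (f : T -> 'M[R]_(m, n)) (h : T -> 'M[R]_(n, p))
    (a : 'M[R]_(m, n)) (b : 'M[R]_(n, p)) :
  f @ F --> a -> h @ F --> b -> f x *m h x @[x --> F] --> a *m b.
Proof.
move=> fa hb; apply: cvg_mx => i j; rewrite mxE; under eq_fun do rewrite mxE.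
by apply: cvg_sum => k; apply: cvgM; exact: cvg_coord.
Qed.

Lemma cvg_trmx (R : realType) m n (T : Type) (F : set_system T)
    {FF : Filter F} (f : T -> 'M[R]_(m, n)) (a : 'M[R]_(m, n)) :
  f @ F --> a -> (f x)^T @[x --> F] --> a^T.
Proof.
move=> fa; apply: cvg_mx => i j; rewrite mxE; under eq_fun do rewrite mxE.
exact: cvg_coord.
Qed.

Lemma cvg_det (R : realType) n (T : Type) (F : set_system T)
    {FF : Filter F} (f : T -> 'M[R]_n) (a : 'M[R]_n) :
  f @ F --> a -> \det (f x) @[x --> F] --> \det a.
Proof.
move=> fa; rewrite /determinant; apply: cvg_sum => s.
by apply: cvgM; [exact: cvg_cst|apply: cvg_prod => i; exact: cvg_coord].
Qed.

(** Open sets of the subtype are traces of open sets, so convergence may be tested in the ambient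
    space. *)
Lemma cvg_set_type (X : topologicalType) (A : set X) (T : Type)
    (F : set_system T) {FF : Filter F} (f : T -> A) (s : A) :
  (fun x => val (f x)) @ F --> val s -> f @ F --> s.
Proof.
move=> fs B /= [_ [[C oC <-] Cs] CB]; rewrite nbhs_simpl/=.
have := fs C (open_nbhs_nbhs (conj oC Cs)); rewrite nbhs_simpl/=.
by apply: filterS => x Cx; exact: CB.
Qed.

Lemma within_open_continuous (X Y : topologicalType) (U : set X) (f : X -> Y) :
  open U -> (forall x, U x -> f @ x --> f x) -> {within U, continuous f}.
Proof.
by move=> Uo fU; rewrite continuous_open_subspace// => x; rewrite inE; exact: fU.
Qed.

(** * The map [calC] and the ordered singular values as functions on its target *)

Definition source (R : realType) := (@calA R * @SO3 R * @SO3 R)%type.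

Lemma sourceP (R : realType) (x : source R) :
  [/\ calA (val x.1.1), SO3 (val x.1.2) & SO3 (val x.2)].
Proof. by split; apply/set_mem; exact: valP. Qed.

Lemma val_cvg (R : realType) (A : set 'M[R]_3) (y : A) :
  val z @[z --> y] --> val y.
Proof. exact: (@initial_continuous _ _ (val : A -> 'M[R]_3) y). Qed.

Lemma source_cvg (R : realType) (x : source R) :
  [/\ val z.1.1 @[z --> x] --> val x.1.1, val z.1.2 @[z --> x] --> val x.1.2 &
      val z.2 @[z --> x] --> val x.2].
Proof.
have vc (A : set 'M[R]_3) (f : source R -> A) : f @ x --> f x ->
    val (f z) @[z --> x] --> val (f x).
  by move=> fx; exact: (cvg_comp f val fx (@val_cvg R A (f x))).
have p1 : z.1 @[z --> x] --> x.1 by exact: cvg_fst.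
split.
- by apply: (vc _ (fun z => z.1.1)); apply: (cvg_comp fst fst p1); exact: cvg_fst.
- by apply: (vc _ (fun z => z.1.2)); apply: (cvg_comp fst snd p1); exact: cvg_snd.
- by apply: (vc _ (fun z => z.2)); exact: cvg_snd.
Qed.

Lemma calC_continuous (R : realType) : continuous (@calC R).
Proof.
move=> x; have [Ac Uc Wc] := source_cvg x; apply: cvg_set_type.
exact: (cvg_mulmx (cvg_mulmx Uc Ac) (cvg_trmx Wc)).
Qed.

Definition diagv (R : realType) (x : source R) : 'rV[R]_3 :=
  \row_i val x.1.1 i i.

Lemma diagvP (R : realType) (x : source R) :
  [/\ val x.1.1 = diag_mx (diagv x), decr3 (diagv x),
      forall i, 0 < diagv x 0 i & \prod_(i < 3) diagv x 0 i = 1].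
Proof.
have [/calAP[a [E ad a0 a1]] _ _] := sourceP x.
suff -> : diagv x = a by [].
by apply/rowP => i; rewrite mxE E mxE eqxx.
Qed.

Lemma calC_surj (R : realType) (y : @Q R) : exists x, calC x = y.
Proof.
have [A [U [W [AA U1 W1 E]]]] := Q_svd (set_mem (valP y)).
exists (exist _ A (mem_set AA), exist _ U (mem_set U1), exist _ W (mem_set W1)).
by apply/val_inj; rewrite /= -E.
Qed.

(** The decreasing singular values, read off a chosen preimage; [alphaE] shows that the choice is
    immaterial. *)
Definition alpha (R : realType) (y : @Q R) : 'rV[R]_3 :=
  diagv (sval (cid (calC_surj y))).

Lemma alphaE (R : realType) (x : source R) : alpha (calC x) = diagv x.
Proof.
rewrite /alpha; case: cid => z /= /(congr1 val)/= zx.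
have [zA zl zr] := sourceP z; have [xA xl xr] := sourceP x.
have [E _ _] := svd_sorted_unique zA xA zl zr xl xr zx.
by rewrite /diagv E.
Qed.

Lemma alphaP (R : realType) (y : @Q R) :
  decr3 (alpha y) /\ forall i, 0 < alpha y 0 i.
Proof. by rewrite /alpha; have [] := diagvP (sval (cid (calC_surj y))). Qed.

(** The shift by [c] serves both the characteristic polynomial of [F *m F^T] and its spectral
    projectors. *)
Lemma gram_rotC (R : realType) (a : 'rV[R]_3) (U W : 'M[R]_3) (c : R) :
  SO3 U -> SO3 W ->
  rotC (diag_mx a) U W *m (rotC (diag_mx a) U W)^T - c%:M =
  U *m diag_mx (\row_i (a 0 i ^+ 2 - c)) *m U^T.
Proof.
move=> [U1 _] W1; rewrite rotC_tr tr_diag_mx /rotC !mulmxA -(mulmxA _ W^T).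
have {1}-> : c%:M = U *m c%:M *m U^T by rewrite scalar_mxC -mulmxA U1 mulmx1.
rewrite SO3_trK// mulmx1 -mulmxBl -(mulmxA U) -mulmxBr; congr (_ *m _ *m _).
apply/matrixP => i j; rewrite mul_diag_mx !mxE.
by case: eqP => _; rewrite ?mulr1n ?mulr0n ?mulr0 ?subr0// expr2.
Qed.

(** For fixed [c] this is visibly continuous in [y], and its roots in [c] are the squared singular
    values. Continuity of [alpha] is derived from it. *)
Definition gram_det (R : realType) (y : @Q R) (c : R) : R :=
  \det (val y *m (val y)^T - c%:M).

Lemma gram_detE (R : realType) (y : @Q R) (c : R) :
  gram_det y c = \prod_(i < 3) (alpha y 0 i ^+ 2 - c).
Proof.
have [x <-] := calC_surj y; have [A1 _ _ _] := diagvP x.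
have [_ U1 W1] := sourceP x; rewrite /gram_det /= A1 gram_rotC// alphaE.
rewrite !det_mulmx det_tr; case: U1 => _ ->; rewrite mulr1 mul1r det_diag.
by apply: eq_bigr => i _; rewrite mxE.
Qed.

Lemma cvg_gram_det (R : realType) (T : Type) (F : set_system T) {FF : Filter F}
    (f : T -> @Q R) (y : @Q R) (c : R) :
  val (f z) @[z --> F] --> val y -> gram_det (f z) c @[z --> F] --> gram_det y c.
Proof.
move=> fy; apply: cvg_det; apply: cvgB; last exact: cvg_cst.
exact: (cvg_mulmx fy (cvg_trmx fy)).
Qed.

(** The test points [b + s] are positive, and since [e] is below half of each gap none of them is a
    root. *)
Lemma cubic_neq0 (R : realType) (b0 b1 b2 e b s : R) :
  b1 < b0 -> b2 < b1 -> 0 < b2 -> 0 < e -> e < b2 ->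
  2 * e < b0 - b1 -> 2 * e < b1 - b2 ->
  b \in [:: b0; b1; b2] -> s \in [:: - e; e] ->
  (b0 ^+ 2 - (b + s) ^+ 2) * (b1 ^+ 2 - (b + s) ^+ 2) * (b2 ^+ 2 - (b + s) ^+ 2)
    != 0.
Proof.
move=> b10 b21 b20 e0 eb2 eb01 eb12.
have sq x c : 0 < x -> 0 < c -> x != c -> x ^+ 2 - c ^+ 2 != 0.
  by move=> x0 c0 xc; rewrite subr_eq0 eqrXn2// ltW.
have b0p : 0 < b0 by lra.
have b1p : 0 < b1 by lra.
move=> bb ss; have [c0 [n0 n1 n2]] :
    0 < b + s /\ [/\ b0 != b + s, b1 != b + s & b2 != b + s].
  by move: bb ss; rewrite !inE => /or3P[] /eqP-> /orP[] /eqP->;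
    (split; [lra|split; apply/eqP; lra]).
by rewrite !mulf_neq0 ?sq.
Qed.

(** Two cubics with equal signs at the six points at distance [e] from the [b]'s: the second changes
    sign between the two points around each [b], so the first has a root there too. *)
Lemma cubic_roots_close (R : realType) (a0 a1 a2 b0 b1 b2 e : R) :
  a1 < a0 -> a2 < a1 -> 0 < a2 -> b1 < b0 -> b2 < b1 -> 0 < e -> e < b2 ->
  2 * e < b0 - b1 -> 2 * e < b1 - b2 ->
  let p x0 x1 x2 c := (x0 ^+ 2 - c) * (x1 ^+ 2 - c) * (x2 ^+ 2 - c) in
  (forall b s, b \in [:: b0; b1; b2] -> s \in [:: - e; e] ->
     0 < p a0 a1 a2 ((b + s) ^+ 2) * p b0 b1 b2 ((b + s) ^+ 2)) ->
  [/\ `|a0 - b0| < e, `|a1 - b1| < e & `|a2 - b2| < e].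
Proof.
move=> a10 a21 a20 b10 b21 e0 eb2 eb01 eb12 p H.
(* The positive factors [x + c] are divided out, which leaves products of linear differences. *)
have sgn c : 0 < c -> 0 < p a0 a1 a2 (c ^+ 2) * p b0 b1 b2 (c ^+ 2) ->
    0 < (a0 - c) * (a1 - c) * (a2 - c) * ((b0 - c) * (b1 - c) * (b2 - c)).
  move=> c0; set q := (X in _ -> 0 < X).
  have k0 : 0 < (a0 + c) * (a1 + c) * (a2 + c) * ((b0 + c) * (b1 + c) * (b2 + c)).
    by rewrite !mulr_gt0//; lra.
  have -> : p a0 a1 a2 (c ^+ 2) * p b0 b1 b2 (c ^+ 2) =
    (a0 + c) * (a1 + c) * (a2 + c) * ((b0 + c) * (b1 + c) * (b2 + c)) * q.
    by rewrite /p /q; ring.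
  by rewrite pmulr_rgt0.
(* Where the cubic of the [b]'s is positive, so is that of the [a]'s; this places [c] among the
   [a]'s. The next claim treats negative values. *)
have neg c : 0 < c -> 0 < p a0 a1 a2 (c ^+ 2) * p b0 b1 b2 (c ^+ 2) ->
    c < b2 \/ b1 < c < b0 -> c < a2 \/ a1 < c < a0.
  move=> c0 /(sgn _ c0) pq bc.
  have qb : 0 < (b0 - c) * (b1 - c) * (b2 - c).
    case: bc => [cb|/andP[bc cb]]; first by rewrite !mulr_gt0//; lra.
    rewrite -mulrA mulr_gt0 ?nmulr_lgt0//; lra.
  move: pq; rewrite pmulr_lgt0// => qa.
  have [|a2c] := ltP c a2; [by left|right].
  have [ca1|a1c] /= := leP c a1.
    exfalso; move: qa; apply/negP; rewrite -leNgt mulr_ge0_le0 ?mulr_ge0//; lra.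
  rewrite ltNge; apply/negP => a0c.
  move: qa; apply/negP; rewrite -leNgt mulr_ge0_le0 ?mulr_le0//; lra.
have pos c : 0 < c -> 0 < p a0 a1 a2 (c ^+ 2) * p b0 b1 b2 (c ^+ 2) ->
    b0 < c \/ b2 < c < b1 -> a0 < c \/ a2 < c < a1.
  move=> c0 /(sgn _ c0) pq bc.
  have qb : (b0 - c) * (b1 - c) * (b2 - c) < 0.
    case: bc => [cb|/andP[bc cb]]; first by rewrite nmulr_llt0 ?nmulr_rgt0//; lra.
    by rewrite pmulr_rlt0 ?mulr_gt0//; lra.
  move: pq; rewrite nmulr_lgt0// => qa.
  have [|ca0] := ltP a0 c; [by left|right].
  have [ca2|a2c] /= := leP c a2.
    exfalso; move: qa; apply/negP; rewrite -leNgt !mulr_ge0//; lra.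
  rewrite ltNge; apply/negP => a1c.
  by move: qa; apply/negP; rewrite -leNgt -mulrA mulr_ge0 ?mulr_le0//; lra.
have h1 : b0 - e < a2 \/ a1 < b0 - e < a0.
  by apply: neg; [lra|apply: H; rewrite !inE eqxx ?orbT|right; lra].
have h2 : b1 + e < a2 \/ a1 < b1 + e < a0.
  by apply: neg; [lra|apply: H; rewrite !inE eqxx ?orbT|right; lra].
have h3 : b2 - e < a2 \/ a1 < b2 - e < a0.
  by apply: neg; [lra|apply: H; rewrite !inE eqxx ?orbT|left; lra].
have h4 : a0 < b0 + e \/ a2 < b0 + e < a1.
  by apply: pos; [lra|apply: H; rewrite !inE eqxx ?orbT|left; lra].
have h5 : a0 < b1 - e \/ a2 < b1 - e < a1.
  by apply: pos; [lra|apply: H; rewrite !inE eqxx ?orbT|right; lra].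
have h6 : a0 < b2 + e \/ a2 < b2 + e < a1.
  by apply: pos; [lra|apply: H; rewrite !inE eqxx ?orbT|right; lra].
(* Both alternatives of [h6] bound [a2]; this bound then eliminates the wrong alternatives of the
   other five one after another. *)
have a2b : a2 < b2 + e by case: h6 => [|/andP[? ?]]; lra.
have /andP[a1b b1a] : a1 < b1 + e < a0 by case: h2 => //; lra.
have /andP[a1b0 b0a] : a1 < b0 - e < a0 by case: h1 => //; lra.
have a0b : a0 < b0 + e by case: h4 => [//|/andP[? ?]]; lra.
have /andP[_ ba1] : a2 < b1 - e < a1 by case: h5 => //; lra.
have ba2 : b2 - e < a2 by case: h3 => [//|/andP[? ?]]; lra.
by rewrite !ltr_norml; split; apply/andP; split; lra.
Qed.

Lemma prod_ord3 (R : realType) (f : 'I_3 -> R) :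
  \prod_(i < 3) f i =
  f ord0 * f (lift ord0 ord0) * f (lift ord0 (lift ord0 ord0)).
Proof. by rewrite !big_ord_recl big_ord0 mulr1 mulrA. Qed.

Lemma ord3P (i : 'I_3) :
  [\/ i = ord0, i = lift ord0 ord0 | i = lift ord0 (lift ord0 ord0)].
Proof.
case: i => [[|[|[|//]]] i3]; [apply: Or31|apply: Or32|apply: Or33];
  exact/val_inj.
Qed.

Lemma cvg_alpha (R : realType) (T : Type) (F : set_system T) {FF : Filter F}
    (f : T -> @Q R) (y : @Q R) i :
  val (f z) @[z --> F] --> val y -> alpha (f z) 0 i @[z --> F] --> alpha y 0 i.
Proof.
move=> fy; apply/cvgrPdist_lt => eps eps0.
have [bd bp] := alphaP y.
pose o1 : 'I_3 := lift ord0 ord0; pose o2 : 'I_3 := lift ord0 (lift ord0 ord0).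
have gE (x : @Q R) c : gram_det x c = (alpha x 0 ord0 ^+ 2 - c) *
    (alpha x 0 o1 ^+ 2 - c) * (alpha x 0 o2 ^+ 2 - c).
  by rewrite gram_detE prod_ord3.
have b10 : alpha y 0 o1 < alpha y 0 ord0 by exact: bd.
have b21 : alpha y 0 o2 < alpha y 0 o1 by exact: bd.
have b2 := bp o2.
have [e [e0 eeps eb2 eb01 eb12]] : exists e, [/\ 0 < e, e <= eps,
    e < alpha y 0 o2, 2 * e < alpha y 0 ord0 - alpha y 0 o1 &
    2 * e < alpha y 0 o1 - alpha y 0 o2].
  (* The divisions by 2 and 3 make the bounds by the smallest singular value and by the half-gaps
     strict. *)
  exists (Num.min (Num.min eps (alpha y 0 o2 / 2))
    (Num.min ((alpha y 0 ord0 - alpha y 0 o1) / 3)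
             ((alpha y 0 o1 - alpha y 0 o2) / 3))).
  set m := Num.min _ _.
  have m1 : m <= eps by rewrite /m !ge_min lexx.
  have m2 : m <= alpha y 0 o2 / 2 by rewrite /m !ge_min lexx !orbT.
  have m3 : m <= (alpha y 0 ord0 - alpha y 0 o1) / 3.
    by rewrite /m !ge_min lexx !orbT.
  have m4 : m <= (alpha y 0 o1 - alpha y 0 o2) / 3.
    by rewrite /m !ge_min lexx !orbT.
  by split=> //; [rewrite /m !lt_min; lra|lra..].
have N b s : b \in [:: alpha y 0 ord0; alpha y 0 o1; alpha y 0 o2] ->
    s \in [:: - e; e] -> \forall z \near F,
      0 < gram_det (f z) ((b + s) ^+ 2) * gram_det y ((b + s) ^+ 2).
  move=> bb ss; have y0 : gram_det y ((b + s) ^+ 2) != 0.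
    by rewrite gE; apply: (cubic_neq0 b10 b21 b2 e0 eb2 eb01 eb12).
  (* The product tends to a nonzero square, so the two signs eventually agree. *)
  have M : gram_det (f z) ((b + s) ^+ 2) * gram_det y ((b + s) ^+ 2) @[z --> F]
      --> gram_det y ((b + s) ^+ 2) * gram_det y ((b + s) ^+ 2).
    by apply: cvgM; [exact: cvg_gram_det|exact: cvg_cst].
  apply: (cvgr_gt _ M).
  by rewrite lt_neqAle eq_sym mulf_neq0//= -expr2 sqr_ge0.
near=> z; apply: lt_le_trans eeps.
have [ad ap] := alphaP (f z).
have [] := @cubic_roots_close R (alpha (f z) 0 ord0) (alpha (f z) 0 o1)
  (alpha (f z) 0 o2) (alpha y 0 ord0) (alpha y 0 o1) (alpha y 0 o2) e => //.
- exact: ad.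
- exact: ad.
- move=> b s bb ss.
  move: bb ss; rewrite !inE => /or3P[] /eqP-> /orP[] /eqP->;
    rewrite -!gE; near: z;
    by apply: N; rewrite !inE eqxx ?orbT.
by move=> h0 h1 h2; rewrite distrC; case: (ord3P i) => ->.
Unshelve. all: by end_near. Qed.

(** * Spectral projectors and the local frame *)

Lemma val_calC (R : realType) (x : source R) :
  val (calC x) = rotC (val x.1.1) (val x.1.2) (val x.2).
Proof. by []. Qed.

(** The Lagrange interpolation polynomial of [F *m F^T] with value 1 at the [i]-th eigenvalue and 0
    at the other two, whose indices are the cyclic successors of [i]. *)
Definition eigenproj (R : realType) (y : @Q R) (i : 'I_3) : 'M[R]_3 :=
  let S := val y *m (val y)^T in
  let m (j : 'I_3) := alpha y 0 j ^+ 2 in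
  let j := ordS i in let k := ordS j in
  ((m i - m j) * (m i - m k))^-1 *: ((S - (m j)%:M) *m (S - (m k)%:M)).

(** In the basis of columns of the left factor the polynomial becomes [delta_mx i i]. The result is
    insensitive to the sign of the column. *)
Lemma eigenprojE (R : realType) (x : source R) (i : 'I_3) :
  eigenproj (calC x) i = col i (val x.1.2) *m (col i (val x.1.2))^T.
Proof.
have [A1 ad a0 _] := diagvP x; have [_ U1 W1] := sourceP x.
rewrite /eigenproj; lazy zeta; rewrite val_calC A1 alphaE !gram_rotC//.
set j := ordS i; set k := ordS j.
move: (val x.1.2) (diagv x) U1 ad a0 => U a U1 ad a0.
rewrite !mulmxA -(mulmxA _ U^T) SO3_trK// mulmx1 -(mulmxA U) scalemxAl scalemxAr.
have sqinj u v : u != v -> a 0 u ^+ 2 - a 0 v ^+ 2 != 0.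
  move=> uv; rewrite subr_eq0 eqrXn2 ?ltW//.
  by apply: contra uv => /eqP/(decr3_inj ad) ->.
have -> : ((a 0 i ^+ 2 - a 0 j ^+ 2) * (a 0 i ^+ 2 - a 0 k ^+ 2))^-1 *:
    (diag_mx (\row_i0 (a 0 i0 ^+ 2 - a 0 j ^+ 2)) *m
     diag_mx (\row_i0 (a 0 i0 ^+ 2 - a 0 k ^+ 2))) = delta_mx i i.
  apply/matrixP => u v; rewrite mxE mul_diag_mx !mxE.
  have [<-|uv] := eqVneq u v; last first.
    rewrite mulr0n !mulr0; case: eqVneq => //= ui.
    by rewrite -ui eq_sym (negPf uv).
  rewrite mulr1n andbb; have [->|ui] := eqVneq u i.
    rewrite mulVf// mulf_neq0// sqinj// -val_eqE /=.
      by case: (i) => [[|[|[|]]]].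
    by case: (i) => [[|[|[|]]]].
  have [->|uj] := eqVneq u j; first by rewrite subrr mul0r mulr0.
  have -> : u = k.
    apply/val_inj => /=; move: ui uj; rewrite -!val_eqE /=.
    by case: (i) => [[|[|[|]]]]//= ?; case: (u) => [[|[|[|]]]].
  by rewrite subrr !mulr0.
by rewrite colE trmx_mul trmx_delta !mulmxA -(mulmxA U) mul_delta_mx.
Qed.

(** Column [i] is the projection of column [i] of [U0] onto the [i]-th eigenline. The columns are
    not normalized. *)
Definition frame (R : realType) (U0 : 'M[R]_3) (y : @Q R) : 'M[R]_3 :=
  \matrix_(r, i) (eigenproj y i *m U0) r i.

Lemma frameE (R : realType) (U0 : 'M[R]_3) (x : source R) :
  frame U0 (calC x) =
  val x.1.2 *m diag_mx (\row_i (U0^T *m val x.1.2) i i).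
Proof.
apply/matrixP => r i; rewrite mul_mx_diag [LHS]mxE eigenprojE -mulmxA.
rewrite [LHS]mxE big_ord1 !mxE; congr (_ * _); apply: eq_bigr => k _; rewrite !mxE.
by rewrite mulrC.
Qed.

Lemma cvg_eigenproj (R : realType) (T : Type) (F : set_system T) {FF : Filter F}
    (f : T -> @Q R) (y : @Q R) i :
  val (f z) @[z --> F] --> val y ->
  eigenproj (f z) i @[z --> F] --> eigenproj y i.
Proof.
move=> fy; have [ad a0] := alphaP y.
have sq j : alpha (f z) 0 j ^+ 2 @[z --> F] --> alpha y 0 j ^+ 2.
  by apply: cvgM; exact: cvg_alpha.
have gr j : val (f z) *m (val (f z))^T - (alpha (f z) 0 j ^+ 2)%:M @[z --> F] -->
    val y *m (val y)^T - (alpha y 0 j ^+ 2)%:M.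
  apply: cvgB; first exact: (cvg_mulmx fy (cvg_trmx fy)).
  apply: cvg_mx => u v; rewrite mxE; under eq_fun do rewrite mxE.
  by case: (u == v); [exact: sq|exact: cvg_cst].
have df j : i != j -> alpha y 0 i ^+ 2 - alpha y 0 j ^+ 2 != 0.
  move=> ij; rewrite subr_eq0 eqrXn2 ?ltW//.
  by apply: contra ij => /eqP/(decr3_inj ad) ->.
rewrite /eigenproj; apply: cvgZ; last exact: cvg_mulmx.
apply: cvgV; last by apply: cvgM; apply: cvgB; exact: sq.
by rewrite mulf_neq0// df// -val_eqE; case: (i) => [[|[|[|]]]].
Qed.

Lemma cvg_frame (R : realType) (T : Type) (F : set_system T) {FF : Filter F}
    (U0 : 'M[R]_3) (f : T -> @Q R) (y : @Q R) :
  val (f z) @[z --> F] --> val y -> frame U0 (f z) @[z --> F] --> frame U0 y.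
Proof.
move=> fy; apply: cvg_mx => r i; rewrite mxE; under eq_fun do rewrite mxE.
apply: cvg_coord; apply: cvg_mulmx; last exact: cvg_cst.
exact: cvg_eigenproj.
Qed.

(** * The four sheets *)

Lemma source_eq (R : realType) (x x' : source R) :
  val x.1.1 = val x'.1.1 -> val x.1.2 = val x'.1.2 -> val x.2 = val x'.2 ->
  x = x'.
Proof.
by case: x x' => [[? ?] ?] [[? ?] ?] /= /val_inj-> /val_inj-> /val_inj->.
Qed.

(** Two preimages differ by a diagonal matrix of signs on both sides. Its [i]-th entry also relates
    the two diagonal entries of the products with [U0^T], so equal signs there force it to be 1. *)
Lemma calC_inj_sign (R : realType) (U0 : 'M[R]_3) (x x' : source R) :
  calC x = calC x' ->
  (forall i, 0 < (U0^T *m val x.1.2) i i * (U0^T *m val x'.1.2) i i) -> x = x'.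
Proof.
move=> /(congr1 val); rewrite !val_calC => E xx'.
have [A1 U1 W1] := sourceP x; have [A1' U1' W1'] := sourceP x'.
have [EA X0 EX] := svd_sorted_unique A1 A1' U1 W1 U1' W1' E.
have SX : SO3 ((val x'.1.2)^T *m val x.1.2).
  by apply: SO3_mul => //; exact: SO3_tr.
set X := _ *m _ in X0 EX SX.
have UX : val x.1.2 = val x'.1.2 *m X.
  by rewrite mulmxA; case: U1' => -> _; rewrite mul1mx.
have WX : val x.2 = val x'.2 *m X.
  by rewrite EX mulmxA; case: W1' => -> _; rewrite mul1mx.
have X1 : X = 1%:M.
  apply/matrixP => i j; rewrite [RHS]mxE.
  have [<-|ij] := eqVneq i j; last exact: X0.
  have Xi : X i i ^+ 2 = 1.
    have [/matrixP/(_ i i) + _] := SX; rewrite mxE (bigD1 i)//= big1 ?addr0.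
      by rewrite !mxE eqxx expr2.
    by move=> k ki; rewrite X0 1?eq_sym// mul0r.
  have := xx' i; rewrite {1}UX mulmxA mxE (bigD1 i)//= big1 ?addr0; last first.
    by move=> k ki; rewrite X0// mulr0.
  set d := (U0^T *m _) i i; rewrite mulrAC -expr2 => dX.
  have Xp : 0 < X i i.
    by rewrite -(pmulr_rgt0 _ (_ : 0 < d ^+ 2))// lt_neqAle sqr_ge0 andbT eq_sym;
      apply: contraTneq dX => ->; rewrite mul0r ltxx.
  by apply/eqP; rewrite -(sqrp_eq1 (ltW Xp)) Xi.
by apply: source_eq => //; rewrite ?UX ?WX X1 mulmx1.
Qed.

(* Sheet [0] carries the identity, sheet [i.+1] the half-turn about axis [i]. *)
Definition sheet_sign (R : realType) (k : 'I_4) (i : 'I_3) : R :=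
  (-1) ^+ ((val k != 0) && (val k != i.+1)).

Definition sheet (R : realType) (U0 : 'M[R]_3) (k : 'I_4) : set (source R) :=
  [set x | forall i, 0 < sheet_sign R k i * (U0^T *m val x.1.2) i i].

(** By [frameE] this determinant is the product of the diagonal of [U0^T *m Ul] for any preimage.
    Its positivity leaves the four sign patterns of product 1, one for each sheet. *)
Definition frame_nbhd (R : realType) (U0 : 'M[R]_3) : set (@Q R) :=
  [set y | 0 < \det (frame U0 y)].

Lemma sheet_signK (R : realType) k i : sheet_sign R k i * sheet_sign R k i = 1.
Proof. by rewrite -expr2 sqrr_sign. Qed.

Lemma prod_sheet_sign (R : realType) k : \prod_i sheet_sign R k i = 1.
Proof.
rewrite prod_ord3 /sheet_sign; case: k => [[|[|[|[|]]]]]//= ?;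
  by rewrite ?expr0 ?expr1 ?mulrNN ?mulr1 ?mul1r ?mulrNN ?mulr1.
Qed.

(** A positive product has no negative factor or exactly two; in the latter case the positive one
    marks the axis of the half-turn. *)
Lemma sheet_sign_exists (R : realType) (d : 'I_3 -> R) : 0 < \prod_i d i ->
  exists k, forall i, 0 < sheet_sign R k i * d i.
Proof.
rewrite prod_ord3 => d012.
have sheetP (k : 'I_4) : (forall i, 0 < sheet_sign R k i * d i) <->
    [/\ 0 < sheet_sign R k ord0 * d ord0,
        0 < sheet_sign R k (lift ord0 ord0) * d (lift ord0 ord0) &
        0 < sheet_sign R k (lift ord0 (lift ord0 ord0)) *
            d (lift ord0 (lift ord0 ord0))].
  by split=> [H|[H0 H1 H2] i]; [split; exact: H|case: (ord3P i) => ->].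
have [d0|d0|d0] := ltgtP (d ord0) 0; last first.
- by move: d012; rewrite d0 !mul0r ltxx.
- have [d1|d1|d1] := ltgtP (d (lift ord0 ord0)) 0; last first.
  + by move: d012; rewrite d1 mulr0 mul0r ltxx.
  + exists ord0; apply/sheetP; rewrite /sheet_sign/= expr0 !mul1r; split=> //.
    by move: d012; rewrite pmulr_rgt0// mulr_gt0.
  + exists (Ordinal (isT : (1 < 4)%N)); apply/sheetP.
    rewrite /sheet_sign/= expr0 expr1 !mulN1r mul1r !oppr_gt0; split=> //.
    by move: d012; rewrite nmulr_rgt0// pmulr_rlt0.
- have [d1|d1|d1] := ltgtP (d (lift ord0 ord0)) 0; last first.
  + by move: d012; rewrite d1 mulr0 mul0r ltxx.
  + exists (Ordinal (isT : (2 < 4)%N)); apply/sheetP.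
    rewrite /sheet_sign/= expr0 expr1 !mulN1r mul1r !oppr_gt0; split=> //.
    by move: d012; rewrite nmulr_rgt0// nmulr_rlt0.
  + exists (Ordinal (isT : (3 < 4)%N)); apply/sheetP.
    rewrite /sheet_sign/= expr0 expr1 !mulN1r mul1r !oppr_gt0; split=> //.
    by move: d012; rewrite pmulr_rgt0// nmulr_rgt0.
Qed.

Lemma sheet_sign_inj (R : realType) (d : 'I_3 -> R) (k l : 'I_4) :
  (forall i, 0 < sheet_sign R k i * d i) ->
  (forall i, 0 < sheet_sign R l i * d i) -> k = l.
Proof.
move=> kd ld; have kl i : sheet_sign R k i = sheet_sign R l i.
  have := mulr_gt0 (kd i) (ld i); rewrite mulrACA -(expr2 (d i)).
  have := sqr_ge0 (d i); rewrite /sheet_sign.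
  by do 2 case: (_ && _) => //=; rewrite expr0 expr1 => *; lra.
have {}kl (i : 'I_3) :
      ((val k != 0) && (val k != i.+1)) = ((val l != 0) && (val l != i.+1)).
  have := kl i; rewrite /sheet_sign; do 2 case: (_ && _) => //=;
  by rewrite expr0 expr1 => ?; exfalso; lra.
apply/val_inj; have := kl ord0; have := kl (lift ord0 ord0).
have := kl (lift ord0 (lift ord0 ord0)).
by case: k l {kd ld kl} => [[|[|[|[|]]]]//= ?] [[|[|[|[|]]]]//= ?].
Qed.

(** A diagonal matrix [D] of signs commutes with the diagonal factor and squares to 1, so
    multiplying both rotations by [D] leaves the image unchanged. *)
Lemma calC_flip (R : realType) (x : source R) (s : 'I_3 -> R) :
  (forall i, s i * s i = 1) -> \prod_i s i = 1 ->
  exists2 x', calC x' = calC x & forall U0 i,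
    (U0^T *m val x'.1.2) i i = s i * (U0^T *m val x.1.2) i i.
Proof.
move=> ss s1; pose D : 'M[R]_3 := diag_mx (\row_i s i).
have [A1 U1 W1] := sourceP x; have [A1E _ _ _] := diagvP x.
have D1 : SO3 D.
  split; last by rewrite det_diag -[RHS]s1; apply: eq_bigr => i _; rewrite mxE.
  rewrite tr_diag_mx; apply/matrixP => i j; rewrite mul_diag_mx !mxE.
  by case: eqVneq => [->|_]; rewrite ?mulr1n ?mulr0n ?mulr0.
have UD := SO3_mul U1 D1; have WD := SO3_mul W1 D1.
pose u : @SO3 R := exist _ (val x.1.2 *m D) (mem_set UD).
pose w : @SO3 R := exist _ (val x.2 *m D) (mem_set WD).
exists (x.1.1, u, w).
  apply/val_inj; rewrite !val_calC /= /rotC trmx_mul tr_diag_mx !mulmxA.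
  congr (_ *m _); rewrite -!mulmxA; congr (_ *m _).
  rewrite mulmxA A1E; apply/matrixP => i j; rewrite mul_mx_diag mul_diag_mx !mxE.
  by case: eqVneq => [->|_]; rewrite ?mulr1n ?mulr0n ?mulr0 ?mul0r// mulrAC ss mul1r.
move=> U0 i; rewrite /= mulmxA mul_mx_diag mxE mulrC; congr (_ * _).
by rewrite mxE.
Qed.

Lemma frame_nbhdE (R : realType) (U0 : 'M[R]_3) (x : source R) :
  frame_nbhd U0 (calC x) <-> 0 < \prod_i (U0^T *m val x.1.2) i i.
Proof.
rewrite /frame_nbhd /= frameE det_mulmx det_diag.
have [_ [_ ->] _] := sourceP x; rewrite mul1r.
by under eq_bigr do rewrite mxE.
Qed.

Lemma frame_nbhd_sheets (R : realType) (U0 : 'M[R]_3) :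
  \bigcup_k sheet U0 k = @calC R @^-1` frame_nbhd U0.
Proof.
apply/seteqP; split=> [x [k _ xk]|x] /=.
  apply/frame_nbhdE; rewrite -[ltRHS]mul1r -{1}(prod_sheet_sign R k).
  rewrite -big_split/=.
  by apply: prodr_gt0 => i _; exact: xk.
by move/frame_nbhdE/sheet_sign_exists => [k xk]; exists k.
Qed.

Lemma sheet_lift (R : realType) (U0 : 'M[R]_3) (k : 'I_4) (y : @Q R) :
  frame_nbhd U0 y -> exists2 x, sheet U0 k x & calC x = y.
Proof.
have [x <-] := calC_surj y => /frame_nbhdE/sheet_sign_exists[l xl].
(* The product of the two sign patterns carries sheet [l] to sheet [k]. *)
have [|| x' <- x'E] := @calC_flip R x (fun i => sheet_sign R k i * sheet_sign R l i).
- by move=> i; rewrite mulrACA !sheet_signK mulr1.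
- by rewrite big_split/= !prod_sheet_sign mulr1.
exists x' => // i; rewrite x'E !mulrA sheet_signK mul1r; exact: xl.
Qed.

Lemma sheet_inj (R : realType) (U0 : 'M[R]_3) (k : 'I_4) (x x' : source R) :
  sheet U0 k x -> sheet U0 k x' -> calC x = calC x' -> x = x'.
Proof.
move=> xk xk' E; apply: (@calC_inj_sign R U0) => // i.
by have := mulr_gt0 (xk i) (xk' i); rewrite mulrACA sheet_signK mul1r.
Qed.

(** With [d] the [i]-th diagonal entry of [U0^T *m Ul], column [i] of [N] is [d] times that of [Ul],
    and [(U0^T *m N) i i = d ^+ 2]. Dividing by the root recovers the column up to the sign of [d],
    which the sheet prescribes. *)
Lemma sheet_frame (R : realType) (U0 : 'M[R]_3) (k : 'I_4) (x : source R) r i :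
  sheet U0 k x ->
  let N := frame U0 (calC x) in 0 < (U0^T *m N) i i /\
  val x.1.2 r i = sheet_sign R k i * (N r i / Num.sqrt ((U0^T *m N) i i)).
Proof.
move=> /(_ i) xk /=; rewrite frameE mulmxA !mul_mx_diag ![(\matrix_(_, _) _) _ _]mxE.
set d := (U0^T *m _) i i in xk *.
have d0 : d != 0 by apply: contraTneq xk => ->; rewrite mulr0 ltxx.
rewrite -expr2 sqrtr_sqr; split.
  by rewrite lt_neqAle eq_sym sqrf_eq0 d0 sqr_ge0.
have -> : `|d| = sheet_sign R k i * d.
  by rewrite -(ger0_norm (ltW xk)) normrM normr_sign mul1r.
have sn : sheet_sign R k i != 0 by rewrite signr_eq0.
by field; rewrite sn d0.
Qed.

(** Solves [F^T *m Ul = Ur *m A] for [Ur], so continuity of the right factor follows from that of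
    the left one. *)
Lemma right_factor (R : realType) (x : source R) r i :
  val x.2 r i =
  ((val (calC x))^T *m val x.1.2) r i / alpha (calC x) 0 i.
Proof.
have [A1 _ a0 _] := diagvP x; have [_ U1 _] := sourceP x.
rewrite alphaE val_calC rotC_tr A1 tr_diag_mx /rotC -mulmxA SO3_trK// mulmx1.
by rewrite mul_mx_diag [(\matrix_(_, _) _) _ _]mxE mulfK// gt_eqF.
Qed.

(** Continuity of the local inverse on a sheet: the diagonal factor is recovered by [alpha], the
    left one by the normalized frame and the right one by [right_factor], all continuous in the
    image. *)
Lemma cvg_lift (R : realType) (T : Type) (F : set_system T) {FF : Filter F}
    (U0 : 'M[R]_3) (k : 'I_4) (h : T -> source R) (x : source R) :
  (\forall z \near F, sheet U0 k (h z)) -> sheet U0 k x ->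
  val (calC (h z)) @[z --> F] --> val (calC x) -> h @ F --> x.
Proof.
move=> hk xk hx.
have hA : val (h z).1.1 @[z --> F] --> val x.1.1.
  have E (z : source R) i j : val z.1.1 i j = alpha (calC z) 0 i *+ (i == j).
    by rewrite alphaE; have [-> _ _ _] := diagvP z; rewrite mxE.
  apply: cvg_mx => i j; rewrite E; under eq_fun do rewrite E.
  by case: (i == j); [exact: cvg_alpha|exact: cvg_cst].
have hN r i : frame U0 (calC (h z)) r i @[z --> F] --> frame U0 (calC x) r i.
  by apply: cvg_coord; exact: cvg_frame.
have hU : val (h z).1.2 @[z --> F] --> val x.1.2.
  apply: cvg_mx => r i; have [N0 ->] := sheet_frame r i xk.
  (* The formula for the column is valid only on the sheet, hence eventually along [F]. *)
  apply: (@cvg_trans _ (sheet_sign R k i * (frame U0 (calC (h z)) r i /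
      Num.sqrt ((U0^T *m frame U0 (calC (h z))) i i)) @[z --> F])).
    apply: near_eq_cvg; apply: filterS hk => z zk.
    by have [_ ->] := sheet_frame r i zk.
  apply: cvgM; first exact: cvg_cst.
  apply: cvgM; first exact: hN.
  apply: cvgV; first by rewrite gt_eqF// sqrtr_gt0.
  have G : (U0^T *m frame U0 (calC (h z))) i i @[z --> F] -->
      (U0^T *m frame U0 (calC x)) i i.
    apply: cvg_coord; apply: cvg_mulmx; first exact: cvg_cst.
    exact: cvg_frame.
  exact: (cvg_comp _ _ G (@sqrt_continuous R _)).
have hW : val (h z).2 @[z --> F] --> val x.2.
  apply: cvg_mx => r i; rewrite right_factor.
  under eq_fun do rewrite right_factor.
  apply: cvgM; first by apply: cvg_coord; exact: cvg_mulmx (cvg_trmx hx) hU.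
  have [_ a0] := alphaP (calC x).
  by apply: cvgV; [rewrite gt_eqF|exact: cvg_alpha].
have hA' : (h z).1.1 @[z --> F] --> x.1.1 by exact: cvg_set_type.
have hU' : (h z).1.2 @[z --> F] --> x.1.2 by exact: cvg_set_type.
have hW' : (h z).2 @[z --> F] --> x.2 by exact: cvg_set_type.
have -> : h = (fun z => ((h z).1.1, (h z).1.2, (h z).2)).
  by apply/funext => z; case: (h z) => [[]].
rewrite (_ : x = (x.1.1, x.1.2, x.2)); last by case: (x) => [[]].
have hAU : ((h z).1.1, (h z).1.2) @[z --> F] --> (x.1.1, x.1.2).
  exact: cvg_pair hA' hU'.
exact: cvg_pair hAU hW'.
Qed.

Lemma sheet_open (R : realType) (U0 : 'M[R]_3) (k : 'I_4) : open (sheet U0 k).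
Proof.
rewrite openE => x xk; have [_ Uc _] := source_cvg x.
suff H : \forall z \near x, forall i : 'I_3,
    0 < sheet_sign R k i * (U0^T *m val z.1.2) i i by exact: H.
apply: (filter_forall (nbhs_filter x)) => i.
have D : sheet_sign R k i * (U0^T *m val z.1.2) i i @[z --> x] -->
    sheet_sign R k i * (U0^T *m val x.1.2) i i.
  apply: cvgM; first exact: cvg_cst.
  by apply: cvg_coord; apply: cvg_mulmx; [exact: cvg_cst|exact: Uc].
exact: (cvgr_gt _ D _ (xk i)).
Qed.

Lemma frame_nbhd_open (R : realType) (U0 : 'M[R]_3) : open (frame_nbhd U0).
Proof.
rewrite openE => y y0.
have vc : val z @[z --> y] --> val y by exact: val_cvg.
have fc : frame U0 z @[z --> y] --> frame U0 y.
  exact: (@cvg_frame R _ (nbhs y) (nbhs_filter y) U0 id y vc).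
have D : \det (frame U0 z) @[z --> y] --> \det (frame U0 y).
  exact: (@cvg_det R _ _ (nbhs y) (nbhs_filter y) _ _ fc).
exact: (cvgr_gt _ D _ y0).
Qed.

(** For [U0] equal to the left factor itself, [U0^T *m U0] is the identity, whose diagonal product
    is positive. *)
Lemma frame_nbhd_self (R : realType) (x : source R) :
  frame_nbhd (val x.1.2) (calC x).
Proof.
apply/frame_nbhdE; have [_ U1 _] := sourceP x.
by rewrite SO3_trK//; apply: prodr_gt0 => i _; rewrite mxE eqxx.
Qed.

Lemma sheet_homeomorphism (R : realType) (U0 : 'M[R]_3) (k : 'I_4) :
  homeomorphism_on (sheet U0 k) (frame_nbhd U0) (@calC R).
Proof.
have sf x : sheet U0 k x -> frame_nbhd U0 (calC x).
  by move=> xk; rewrite -[frame_nbhd U0 _]/((@calC R @^-1` frame_nbhd U0) x)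
    -frame_nbhd_sheets; exists k.
(* The inverse on the sheet, extended by an arbitrary value outside the neighbourhood. *)
have /choice[q qP] : forall y, exists x,
    frame_nbhd U0 y -> sheet U0 k x /\ calC x = y.
  move=> y; have [/(sheet_lift k)[x xk xy]|ny] := pselect (frame_nbhd U0 y).
    by exists x.
  by have [x _] := calC_surj y; exists x.
split; first exact: sf.
  by apply: continuous_subspaceT; exact: calC_continuous.
exists q; split.
- by move=> y /qP[].
- apply: within_open_continuous; first exact: frame_nbhd_open.
  move=> y yU; have [yk yE] := qP y yU.
  have nU := open_nbhs_nbhs (conj (@frame_nbhd_open R U0) yU).
  have qk : \forall z \near y, sheet U0 k (q z).
    by apply: (@filterS _ _ (nbhs_filter y) _ _ _ nU) => z /qP[].
  have qc : val (calC (q z)) @[z --> y] --> val (calC (q y)).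
    rewrite yE; apply: (@cvg_trans _ (val z @[z --> y])); last exact: val_cvg.
    have H : \forall z \near y, val z = val (calC (q z)).
      by apply: (@filterS _ _ (nbhs_filter y) _ _ _ nU) => z /qP[_ ->].
    exact: (@near_eq_cvg _ _ (nbhs y) (nbhs_filter y) _ _ H).
  exact: (@cvg_lift R _ (nbhs y) (nbhs_filter y) U0 k q (q y) qk yk qc).
- move=> x xk; have [qk qE] := qP _ (sf x xk); exact: (sheet_inj qk xk).
- by move=> y /qP[].
Qed.

Lemma calC_covering (R : realType) : covering_map 4 (@calC R).
Proof.
split; first exact: calC_continuous.
move=> y; have [x xy] := calC_surj y; pose U0 := val x.1.2.
exists (frame_nbhd U0).
  by split; [exact: frame_nbhd_open|rewrite -xy; exact: frame_nbhd_self].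
exists (sheet U0); split.
- exact: sheet_open.
- by move=> k l _ _ [z [zk zl]]; exact: sheet_sign_inj zk zl.
- exact: frame_nbhd_sheets.
- exact: sheet_homeomorphism.
Qed.

Theorem proposition1 (R : realType) (g : R) (g_gt0 : 0 < g) :
  covering_map 4 (@calC R) /\
  (forall (I : set R) (A Ul Ur : R -> 'M[R]_3),
     open I -> is_interval I ->
     riemann_solution g I A Ul Ur ->
     dirichlet_solution g I (fun t => rotC (A t) (Ul t) (Ur t))).
Proof.
split; first exact: calC_covering.
by move=> I A Ul Ur Io _; exact: riemann_dirichlet.
Qed.
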